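(* If $B$ is a D-algebra, then the set of derivations $\operatorname{Der}(B)$ forms a post-Lie algebra, with torsion (Lie bracket) $[u,v]=uv-vu$ and connection given by the product $\triangleright$ of $B$ restricted to $\operatorname{Der}(B)$.
   Context: All algebras are vector spaces over a field $\mathrm{k}$ of characteristic $0$ and all products are bilinear. Post-Lie algebra: a Lie algebra $\{\mathcal{A},[\cdot,\cdot]\}$ (the bracket is called the torsion) together with a bilinear product $\triangleright\colon\mathcal{A}\times\mathcal{A}\to\mathcal{A}$ (called the connection) such that for all $x,y,z\in\mathcal{A}$: $x\triangleright[y,z]=[x\triangleright y,z]+[y,x\triangleright z]$ and $[x,y]\triangleright z=a_\triangleright(x,y,z)-a_\triangleright(y,x,z)$, where $a_\triangleright(x,y,z):=x\triangleright(y\triangleright z)-(x\triangleright y)\triangleright z$. D-algebra: let $B$ be a unital associative algebra with product $u,v\mapsto uv$ and unit $\mathbb{1}$, equipped with a non-associative product $\triangleright\colon B\otimes B\to B$ such that $\mathbb{1}\triangleright v=v$ for all $v\in B$. Put $$\operatorname{Der}(B)=\{u\in B \mid u\triangleright(vw)=(u\triangleright v)w+v(u\triangleright w)\ \text{for all } v,w\in B\}.$$ $B$ is a D-algebra if the associative product generates $B$ from $\{\mathbb{1},\operatorname{Der}(B)\}$ and, for any $u\in\operatorname{Der}(B)$ and any $v,w\in B$, one has $v\triangleright u\in\operatorname{Der}(B)$ and $(uv)\triangleright w=u\triangleright(v\triangleright w)-(u\triangleright v)\triangleright w$. *)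

(* Defs.v *)
From HB Require Import structures.
From mathcomp Require Import all_boot all_algebra boolp.

Set Implicit Arguments.
Unset Strict Implicit.
Unset Printing Implicit Defensive.

Import GRing.Theory.
Local Open Scope ring_scope.

(* algType would force 1 != 0, so a unital associative k-algebra is a vector
   space with an associative bilinear product and a unit; the zero algebra is
   thus allowed. *)
Record is_unital_assoc (k : fieldType) (B : lmodType k)
    (mul : {bilinear B -> B -> B}) (one : B) : Prop := {
  unital_assoc_mulA : associative mul;
  unital_assoc_mul1l : left_id one mul;
  unital_assoc_mul1r : right_id one mul
}.

Record is_lie (k : fieldType) (A : lmodType k)
    (br : {bilinear A -> A -> A}) : Prop := {
  lie_alternating : forall x, br x x = 0;
  lie_jacobi : forall x y z, br x (br y z) + br y (br z x) + br z (br x y) = 0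
}.

(* This is x |> (y |> z) - (x |> y) |> z, the sign convention of post-Lie
   algebras. *)
Definition associator (k : fieldType) (A : lmodType k)
    (tr : {bilinear A -> A -> A}) (x y z : A) : A :=
  tr x (tr y z) - tr (tr x y) z.

Record is_post_lie (k : fieldType) (A : lmodType k)
    (br tr : {bilinear A -> A -> A}) : Prop := {
  post_lie_lie : is_lie br;
  post_lie_derivation : forall x y z,
    tr x (br y z) = br (tr x y) z + br y (tr x z);
  post_lie_associator : forall x y z,
    tr (br x y) z = associator tr x y z - associator tr y x z
}.

Section Derivations.
Variables (k : fieldType) (B : lmodType k).
Variables (mul tr : {bilinear B -> B -> B}).

Definition Der : {pred B} :=
  fun u => `[< forall v w, tr u (mul v w) = mul (tr u v) w + mul v (tr u w) >].

Lemma Der_submod_closed : submod_closed Der.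
Proof.
split=> [|a u v /asboolP du /asboolP dv]; apply/asboolP => x y.
  by rewrite !linear0l linear0r addr0.
by rewrite !linearPl linearPr du dv scalerDr addrACA.
Qed.

HB.instance Definition _ := GRing.isSubmodClosed.Build k B Der Der_submod_closed.

(* The subspace Der as a vector space in its own right. *)
Record der_type := DerType { der_val : B; _ : der_val \in Der }.

HB.instance Definition _ := [isSub for der_val].
HB.instance Definition _ := [Choice of der_type by <:].
HB.instance Definition _ := [SubChoice_isSubLmodule of der_type by <:].

(* d_algebra_generated: every subalgebra of B that contains the unit and Der
   is the whole of B. *)
Record is_d_algebra (one : B) : Prop := {
  d_algebra_unital_assoc : is_unital_assoc mul one;
  d_algebra_unit : forall v, tr one v = v;
  d_algebra_generated : forall S : {pred B},
    one \in S -> linear_closed S ->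
    {in S &, forall u v, mul u v \in S} -> {subset Der <= S} ->
    forall v, v \in S;
  d_algebra_closed : forall u v, u \in Der -> tr v u \in Der;
  d_algebra_assoc : forall u v w, u \in Der ->
    tr (mul u v) w = tr u (tr v w) - tr (tr u v) w
}.

End Derivations.

(* Main.v *)
(* For derivations u and v the relation (uv)|>w = u|>(v|>w) - (u|>v)|>w shows
   that [u,v] acts as the commutator of the operators u|> and v|> minus the
   derivation u|>v - v|>u; hence [u,v] is again a derivation. The same relation
   is the torsion axiom, and the other axioms are the Leibniz rule for
   derivations and the Jacobi identity for associative commutators. *)
Require Import Defs.
From mathcomp Require Import all_boot all_algebra.
From HB Require Import structures.
From mathcomp Require Import boolp.
Import GRing.Theory.
Local Open Scope ring_scope.

(** Used for both the torsion and the connection on [der_type]. Values are computed in [V], so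
    bilinearity descends because [val] is linear and injective. [f] is a bare function so that the
    commutator can be passed directly. *)
Lemma bilinear_restrict (R : nzRingType) (V : lmodType R) (S : {pred V})
    (W : subLmodType S) (f : V -> V -> V) :
  bilinear_for *:%R *:%R f -> {in S &, forall u v, f u v \in S} ->
  exists g : {bilinear W -> W -> W},
    forall u v, val (g u v) = f (val u) (val v).
Proof.
move=> f_bilin f_closed.
pose g (u v : W) : W := Sub (f (val u) (val v)) (f_closed _ _ (valP u) (valP v)).
have gE u v : val (g u v) = f (val u) (val v) by exact: SubK.
have g_bilin : bilinear_for *:%R *:%R g.
  split=> [u a x y|u a x y]; apply: val_inj.
    by rewrite [RHS]linearP /= !gE linearP; exact: f_bilin.1.
  by rewrite [RHS]linearP /= !gE linearP; exact: f_bilin.2.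
pose G : {bilinear W -> W -> W} :=
  HB.pack g (bilinear_isBilinear.Build R W W W *:%R *:%R g g_bilin).
by exists G.
Qed.

Lemma commutator_bilinear (R : nzRingType) (V : lmodType R)
    (mul : {bilinear V -> V -> V}) :
  bilinear_for *:%R *:%R (fun u v => mul u v - mul v u).
Proof.
by split=> u a x y /=; rewrite linearPl linearPr /= opprD scalerBr addrACA.
Qed.

Lemma commutator_jacobi (R : nzRingType) (V : lmodType R)
    (mul : {bilinear V -> V -> V}) : associative mul -> forall x y z,
  let br u v := mul u v - mul v u in
  br x (br y z) + br y (br z x) + br z (br x y) = 0.
Proof.
move=> mulA x y z /=; rewrite !linearBr !linearBl /= !mulA !opprB.
(* The six differences are ordered into a closed telescoping chain: xyz, xzy, zxy, zyx, yzx, yxz and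
   back to xyz. *)
by rewrite (AC ((2*2)*2) (1*4*5*2*3*6))/= !subrKA subrr.
Qed.

Section DAlgebra.
Variables (k : fieldType) (B : lmodType k) (mul tr : {bilinear B -> B -> B}).
Variable one : B.
Hypothesis dB : is_d_algebra mul tr one.

Lemma DerP (u : B) :
  reflect (forall v w, tr u (mul v w) = mul (tr u v) w + mul v (tr u w))
    (u \in Der mul tr).
Proof. exact: asboolP. Qed.

(** Here [w] ranges over all of [B]: the Leibniz rule for the commutator is tested on arbitrary
    products, while the torsion axiom takes [w] in [Der]. *)
Lemma tr_commutator (u v w : B) : u \in Der mul tr -> v \in Der mul tr ->
  tr (mul u v - mul v u) w = associator tr u v w - associator tr v u w.
Proof.
by move=> du dv; rewrite linearBl /= !(d_algebra_assoc dB).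
Qed.

Lemma Der_commutator :
  {in Der mul tr &, forall u v, mul u v - mul v u \in Der mul tr}.
Proof.
move=> u v du dv.
have d_tr : tr u v - tr v u \in Der mul tr.
  by rewrite rpredB ?(d_algebra_closed dB).
have tr_comm w : tr (mul u v - mul v u) w =
    tr u (tr v w) - tr v (tr u w) - tr (tr u v - tr v u) w.
  rewrite tr_commutator // /associator linearBl /= !opprB.
  by rewrite [LHS](AC (2*2) (1*4*(3*2))).
have [[Lu Lv] L] := (DerP _ du, DerP _ dv, DerP _ d_tr).
apply/DerP => a b.
rewrite !tr_comm L !Lu !Lv !linearD /= !Lu !Lv.
rewrite !linearNr !linearBl /= !opprD.
(* The first two groups are the two Leibniz terms on the right. The pairs 2, 7 and 3, 6 are the
   mixed products of [tr v a] with [tr u b] and of [tr u a] with [tr v b], each occurring with both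
   signs. *)
rewrite [LHS](AC (((2*2)*(2*2))*2) (((1*5*9)*(4*8*10))*((2*7)*(3*6)))) /=.
by rewrite !subrr !addr0.
Qed.

End DAlgebra.

Theorem proposition3p6 (k : fieldType) (char0 : [pchar k] =i pred0)
    (B : lmodType k) (mul tr : {bilinear B -> B -> B}) (one : B) :
  is_d_algebra mul tr one ->
  exists br con : {bilinear der_type mul tr -> der_type mul tr -> der_type mul tr},
    [/\ is_post_lie br con,
        forall u v : der_type mul tr,
          der_val (br u v) =
          mul (der_val u) (der_val v) - mul (der_val v) (der_val u)
      & forall u v : der_type mul tr,
          der_val (con u v) = tr (der_val u) (der_val v)].
Proof.
move=> dB.
have tr_bilin : bilinear_for *:%R *:%R tr.
  by split=> u a x y; rewrite ?linearPl ?linearPr.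
have tr_closed : {in Der mul tr &, forall u v, tr u v \in Der mul tr}.
  by move=> u v _ dv; exact: (d_algebra_closed dB).
have [br brE] := bilinear_restrict _ _ _ (der_type mul tr) _
  (commutator_bilinear _ _ mul) (Der_commutator _ _ _ _ _ dB).
have [con conE] := bilinear_restrict _ _ _ (der_type mul tr) _
  tr_bilin tr_closed.
have Du (u : der_type mul tr) : val u \in Der mul tr by exact: valP.
exists br, con; split=> //; split.
(* Each axiom is checked in [B], through the injective linear map [val]. *)
- split=> [x|x y z]; apply: val_inj; first by rewrite brE subrr linear0.
  rewrite !linearD linear0 /= !brE; apply: commutator_jacobi.
  exact: (unital_assoc_mulA (d_algebra_unital_assoc dB)).
- move=> x y z; apply: val_inj; rewrite linearD /= conE !brE !conE linearBr /=.
  (* Leibniz on yz and zy gives four terms; the outer two form the bracket of x|>y with z, the inner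
     two that of y with x|>z. *)
  by rewrite !(DerP _ _ _ _ _ (Du x)) opprD [LHS](AC (2*2) (1*4*(2*3))).
- move=> x y z; apply: val_inj; rewrite conE brE.
  by rewrite (tr_commutator _ _ _ _ _ dB) // /associator !linearB /= !conE.
Qed.
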